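(* Let $(M,d)$ be a metric space and let $S$ be a subset of $M$. Let $(\Omega,\Sigma,\mu)$ be a finite measure space and let $\phi:\Sigma\to\mathbb R^+$ be an increasing and bounded set function. Suppose that $T:S\to L^1(\mu)$ is a $\phi$-Lipschitz map, where $L^1(\mu)$ is endowed with the norm $\|\cdot\|_{L^1(\mu),0}$. The following statements hold. (1) Suppose that for each $x\in M$ the set function $\nu_x:\Sigma\to\mathbb R$ given by $$\nu_x(A):=\sup_{y\in S}\Big\{\int_A T(y)\,d\mu-\phi(A)\,d(x,y)\Big\},\quad A\in\Sigma,$$ is a $\mu$-continuous (countably additive) measure. Then $T$ admits a $\phi$-Lipschitz extension to $M$ into $L^1(\mu)$ (endowed with $\|\cdot\|_{L^1(\mu),0}$). (2) Conversely, if $T$ can be extended to all the space $M$ as a $\phi$-Lipschitz map into $(L^1(\mu),\|\cdot\|_{L^1(\mu),0})$, with the extension again denoted by $T$, then for each $x\in M$ the set function $$\hat\nu_x(A):=\sup_{y\in M}\Big\{\int_A T(y)\,d\mu-\phi(A)\,d(x,y)\Big\},\quad A\in\Sigma,$$ is a $\mu$-continuous (countably additive) measure. Moreover, in this case $$|\|\hat\nu_x\||=\|T(x)\|_{L^1(\mu),0},\qquad |\hat\nu_x|=\|T(x)\|_{L^1(\mu)},\qquad |\hat\nu_x(A)-\hat\nu_y(A)|\le\phi(A)\,d(x,y)$$ for all $x,y\in M$ and $A\in\Sigma$.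
   Context: The norm $\|\cdot\|_{L^1(\mu),0}$ on $L^1(\mu)$ is $\|f\|_{L^1(\mu),0}:=\sup_{A\in\Sigma}\big|\int_A f\,d\mu\big|$; it is equivalent to the usual norm of $L^1(\mu)$. A set function $\phi:\Sigma\to\mathbb R^+=[0,\infty)$ is increasing if $\phi(B)\le\phi(A)$ whenever $A,B\in\Sigma$, $B\subseteq A$, and bounded if $\sup_{A\in\Sigma}\phi(A)<\infty$. A Lipschitz map $T$ from a metric space $(M,d)$ into a normed space $Y$ of classes of $\mu$-a.e. equal measurable functions is $\phi$-Lipschitz if $$\|(T(x)-T(y))\chi_A\|_Y\le\phi(A)\,d(x,y)$$ for all $x,y\in M$ and all $A\in\Sigma$; the same definition applies to maps on a subset $S\subset M$. For a finite real measure $\nu$ on $\Sigma$, its semivariation is $|\|\nu\||=\sup_{B\in\Sigma}|\nu(B)|$ and its variation is $|\nu|=\sup_{g\in B_{L^\infty(\nu)}}\big|\int g\,d\nu\big|$, where $B_X$ denotes the closed unit ball of $X$. *)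

(* Defs.v *)
From HB Require Import structures.
From mathcomp Require Import all_boot all_order all_algebra.
From mathcomp Require Import all_classical all_reals all_analysis.

Set Implicit Arguments.
Unset Strict Implicit.
Unset Printing Implicit Defensive.

Import Order.TTheory GRing.Theory Num.Theory.
Import numFieldNormedType.Exports.

Local Open Scope classical_set_scope.
Local Open Scope ring_scope.
Local Open Scope ereal_scope.

Section L1norm0.
Context d (Omega : measurableType d) (R : realType).

(* Invariant under mu-a.e. equality, hence a norm on L^1(mu); it is stated on
   functions so that it applies to the representatives of classes. *)
Definition L1norm0 (mu : {measure set Omega -> \bar R}) (f : Omega -> R) :
    \bar R :=
  ereal_sup [set `|\int[mu]_(w in A) (f w)%:E| | A in measurable].

End L1norm0.

Section set_functions.
Context d (Omega : measurableType d) (R : realType).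
Implicit Types phi : set Omega -> R.

(* Set functions on Sigma are total functions on [set Omega] of which only the
   values on measurable sets are ever considered. *)
Definition nonneg_set_function phi :=
  forall A, measurable A -> (0 <= phi A)%R.

Definition increasing_set_function phi :=
  forall A B, measurable A -> measurable B -> B `<=` A -> (phi B <= phi A)%R.

Definition bounded_set_function phi :=
  ereal_sup [set (phi A)%:E | A in measurable] < +oo.

(* A [charge] is by definition finite on measurable sets, so this also says
   that nu is real-valued on Sigma. *)
Definition continuous_measure (mu : {measure set Omega -> \bar R})
    (nu : set Omega -> \bar R) :=
  exists2 c : {charge set Omega -> \bar R},
    forall A, measurable A -> c A = nu A & c `<< mu.

Definition semivariation (nu : set Omega -> \bar R) : \bar R :=
  ereal_sup [set `|nu B| | B in measurable].

End set_functions.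

Section phi_lipschitz.
Context d (Omega : measurableType d) (R : realType) (M : metricType R).

(* [T] is a map on [S]: its values outside of [S] are irrelevant.  [N] is the
   norm of the target space of classes of functions. *)
Definition phi_lipschitz (N : (Omega -> R) -> \bar R) (phi : set Omega -> R)
    (S : set M) (T : M -> Omega -> R) :=
  (exists K : R, forall x y, S x -> S y ->
     N (T x \- T y)%R <= (K * mdist x y)%:E) /\
  (forall x y A, S x -> S y -> measurable A ->
     N ((T x \- T y) \* \1_A)%R <= (phi A * mdist x y)%:E).

Definition sup_measure (mu : {measure set Omega -> \bar R})
    (phi : set Omega -> R) (S : set M) (T : M -> Omega -> R) (x : M)
    (A : set Omega) : \bar R :=
  ereal_sup [set \int[mu]_(w in A) (T y w)%:E - (phi A * mdist x y)%:E
            | y in S].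

End phi_lipschitz.

(* The variation of a signed measure, through integration with respect to its
   Jordan decomposition; nothing depends on the Hahn decomposition chosen. *)
Section variation.
Context d (Omega : measurableType d) (R : realType).
Variable nu : {charge set Omega -> \bar R}.

Definition hahnP : set Omega := sval (cid (Hahn_decomposition nu)).
Definition hahnN : set Omega := sval (cid (svalP (cid (Hahn_decomposition nu)))).

Lemma hahnPN : hahn_decomposition nu hahnP hahnN.
Proof. exact: svalP (cid (svalP (cid (Hahn_decomposition nu)))). Qed.

Definition charge_integral (g : Omega -> R) : \bar R :=
  \int[jordan_pos hahnPN]_w (g w)%:E - \int[jordan_neg hahnPN]_w (g w)%:E.

Definition charge_Linfty := LspaceType (charge_variation hahnPN) (leey 1).

Definition signed_variation : \bar R :=
  ereal_sup [set `|charge_integral g|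
            | g in [set g : charge_Linfty
                   | 'N[charge_variation hahnPN]_+oo[EFin \o g] <= 1]].

End variation.

(* Main.v *)
Require Import Defs.
From HB Require Import structures.
From mathcomp Require Import all_boot all_order all_algebra.
From mathcomp Require Import all_classical all_reals all_analysis.
From mathcomp Require Import measurable_realfun ess_sup_inf.

Set Implicit Arguments.
Unset Strict Implicit.
Unset Printing Implicit Defensive.

Import Order.TTheory GRing.Theory Num.Theory.
Import numFieldNormedType.Exports.

Local Open Scope classical_set_scope.
Local Open Scope ring_scope.
Local Open Scope ereal_scope.

(** Testing the norm of [(T x - T y) * 1_A] on the measurable subsets of [A], and
using that [phi] is increasing, shows that [T] is phi-Lipschitz for the norm
[sup_A |int_A f|] exactly when
[|int_A T x - int_A T y| <= phi A * d(x, y)] for every single measurable [A]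
([phi_lipschitz_L1norm0P]). For fixed [A] this says that the real function
[x |-> int_A T x] is Lipschitz with constant [phi A], and [sup_measure] is its
McShane extension: it agrees with [int_A T x] on the domain of [T]
([sup_measure_id]) and is again Lipschitz with constant [phi A]
([setwise_lipschitz_sup_measure]).

(1) If all these scalar extensions fit together into a mu-continuous measure
[nu_x], then [nu_x] has a density with respect to [mu] by Radon-Nikodym; choosing
[T x] itself as the density when [x] is in [S], the densities extend [T].

(2) If [T] is already defined on the whole of [M], then the McShane extension
changes nothing, so that [hat nu_x A = int_A T x]: this is the measure of density
[T x], whence its continuity, its semivariation and the Lipschitz estimate. For
its variation, the Hahn decomposition [(P, N)] shows that the variation of any
charge [nu], defined by integration against the unit ball of [L^oo], is the total
mass of [nu^+ + nu^-], attained at [1_P - 1_N] ([signed_variationE]); for a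
measure of density [f] this mass is [int |f|], as one sees by comparing [(P, N)]
with the sets where [f >= 0] and [f < 0] ([signed_variation_density]). *)

(** * Classes of functions in [L^p] *)

Section Lp_classes.
Context d (Omega : measurableType d) (R : realType).
Variable mu : {measure set Omega -> \bar R}.

Lemma ae_eq_Lnorm (p : \bar R) (f g : Omega -> \bar R) :
  measurable_fun [set: Omega] f -> measurable_fun [set: Omega] g ->
  ae_eq mu setT f g -> 'N[mu]_p[f] = 'N[mu]_p[g].
Proof.
move=> mf mg fg.
have afg : \forall x \ae mu, (abse \o f) x = (abse \o g) x.
  by apply: filterS fg => x /(_ I) /= ->.
rewrite unlock; case: p => [r| |].
- congr (_ `^ _); apply: ae_eq_integral => //.
  + apply: (measurableT_comp (measurable_poweR _)) => //.
    exact: measurableT_comp.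
  + apply: (measurableT_comp (measurable_poweR _)) => //.
    exact: measurableT_comp.
  + by apply: filterS fg => x /(_ I) /= ->.
- by rewrite (eq_ess_sup afg).
- by rewrite (eq_ess_inf afg).
Qed.

(** Elements of [LspaceType] are classes of functions that act through a chosen
representative; the class of [f] is therefore a function that agrees with [f]
only almost everywhere. *)
Lemma exists_Lspace_class (p : \bar R) (p1 : 1 <= p) (f : Omega -> R) :
  measurable_fun [set: Omega] f -> finite_norm mu p f ->
  exists g : LspaceType mu p1, ae_eq mu setT (g : Omega -> R) f.
Proof.
move=> mf ff.
pose m := @isMeasurableFun.Build _ _ Omega (measurableTypeR R) f mf.
pose F : {mfun Omega >-> measurableTypeR R} := HB.pack f m.
pose q : {mfun_ mu, Omega >-> measurableTypeR R} := (\pi F)%qT.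
have qf : ae_eq mu setT (q : Omega -> R) f.
  have /eqmodP/asboolP :
      (repr q = F %[mod {mfun_ mu, Omega >-> measurableTypeR R}])%qT.
    by rewrite reprK.
  by apply.
have fq : finite_norm mu p q.
  rewrite /finite_norm (_ : 'N[mu]_p[EFin \o q] = 'N[mu]_p[EFin \o f])//.
  apply: ae_eq_Lnorm.
  - by apply/measurable_EFinP; exact: measurable_funPT (repr q).
  - exact/measurable_EFinP.
  - by apply: filterS qf => x /(_ I) /= ->.
pose g : LspaceType mu p1 :=
  HB.pack q (isFinLebesgue.Build d Omega R mu p p1 q fq).
by exists g.
Qed.

Lemma measurable_Lspace (p : \bar R) (p1 : 1 <= p) (g : LspaceType mu p1) :
  measurable_fun [set: Omega] (g : Omega -> R).
Proof. exact: measurable_funPT (repr (LebesgueSpace.sort g)). Qed.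

Lemma Lspace1_integrable (f : LspaceType1 mu) :
  mu.-integrable setT (EFin \o (f : Omega -> R)).
Proof.
apply/integrableP; split; first exact/measurable_EFinP/measurable_Lspace.
have := @Lebesgue_finite _ _ _ _ _ _ f.
by rewrite /finite_norm Lnorm1.
Qed.

End Lp_classes.

(** * Setwise form of the phi-Lipschitz condition, and the McShane extension *)

Section L1norm0_lemmas.
Context d (Omega : measurableType d) (R : realType).
Variable mu : {measure set Omega -> \bar R}.
Implicit Types (f g : Omega -> R) (A B : set Omega).

Lemma integral_mul_indic f A B :
  \int[mu]_(w in A) ((f \* \1_B)%R w)%:E = \int[mu]_(w in A `&` B) (f w)%:E.
Proof.
rewrite integral_mkcondr; apply: eq_integral => w _.
by rewrite patchE /= indicE; case: ifPn => _; rewrite ?mulr1 ?mulr0.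
Qed.

Lemma abse_integral_le_L1norm0 f A : measurable A ->
  `|\int[mu]_(w in A) (f w)%:E| <= L1norm0 mu f.
Proof. by move=> mA; apply: ereal_sup_ubound; exists A. Qed.

Lemma L1norm0_le f (b : \bar R) :
  (forall A, measurable A -> `|\int[mu]_(w in A) (f w)%:E| <= b) ->
  L1norm0 mu f <= b.
Proof. by move=> fb; apply: ge_ereal_sup => _ [A mA <-]; exact: fb. Qed.

Lemma integralB_L1 f g A : measurable A ->
  mu.-integrable setT (EFin \o f) -> mu.-integrable setT (EFin \o g) ->
  \int[mu]_(w in A) ((f \- g)%R w)%:E =
  \int[mu]_(w in A) (f w)%:E - \int[mu]_(w in A) (g w)%:E.
Proof.
move=> mA intf intg; rewrite -integralB_EFin//; last 2 first.
- exact: integrableS intf.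
- exact: integrableS intg.
Qed.

End L1norm0_lemmas.

Section setwise_bound.
Context d (Omega : measurableType d) (R : realType) (M : metricType R).
Variables (mu : {measure set Omega -> \bar R}) (phi : set Omega -> R).
Hypotheses (phi_ge0 : nonneg_set_function phi)
  (phi_incr : increasing_set_function phi).
Implicit Types (S : set M) (T : M -> Omega -> R).

Definition setwise_lipschitz (nu : M -> set Omega -> \bar R) S :=
  forall x y A, S x -> S y -> measurable A ->
    `|nu x A - nu y A| <= (phi A * mdist x y)%:E.

(** Evaluating the integral of [(T x - T y) * 1_A] over [B] gives the difference
of the integrals over [B `&` A]. The choice [B = A] gives one direction; in the
other, [phi (B `&` A) <= phi A] bounds all the [B] at once, and [phi setT] serves
as a global Lipschitz constant. *)
Lemma phi_lipschitz_L1norm0P S T :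
  (forall x, mu.-integrable setT (EFin \o T x)) ->
  phi_lipschitz (L1norm0 mu) phi S T <->
  setwise_lipschitz (fun x A => \int[mu]_(w in A) (T x w)%:E) S.
Proof.
move=> intT.
have normE x y A B : measurable A -> measurable B ->
    \int[mu]_(w in B) (((T x \- T y) \* \1_A)%R w)%:E =
    \int[mu]_(w in B `&` A) (T x w)%:E - \int[mu]_(w in B `&` A) (T y w)%:E.
  by move=> mA mB; rewrite integral_mul_indic integralB_L1//; exact: measurableI.
split=> [[_ Tphi] x y A Sx Sy mA|Tphi].
  apply: le_trans (Tphi x y A Sx Sy mA).
  have := abse_integral_le_L1norm0 mu ((T x \- T y) \* \1_A)%R mA.
  by rewrite normE// setIid.
have Tphi' x y A : S x -> S y -> measurable A ->
    L1norm0 mu ((T x \- T y) \* \1_A)%R <= (phi A * mdist x y)%:E.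
  move=> Sx Sy mA; apply: L1norm0_le => B mB; rewrite normE//.
  have mBA : measurable (B `&` A) by exact: measurableI.
  apply: le_trans (Tphi x y _ Sx Sy mBA) _.
  by rewrite lee_fin ler_wpM2r ?mdist_ge0// phi_incr.
split=> //; exists (phi setT) => x y Sx Sy.
apply: le_trans (Tphi' x y setT Sx Sy measurableT).
rewrite indicT (_ : (_ \* cst 1)%R = (T x \- T y)%R)//.
by apply/funext => w; rewrite /= mulr1.
Qed.

(** The term [y = x] of the supremum is [int_A T x], and the Lipschitz bound says
that no other term exceeds it. *)
Lemma sup_measure_id S T x A :
  (forall x, mu.-integrable setT (EFin \o T x)) ->
  setwise_lipschitz (fun x A => \int[mu]_(w in A) (T x w)%:E) S ->
  S x -> measurable A ->
  sup_measure mu phi S T x A = \int[mu]_(w in A) (T x w)%:E.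
Proof.
move=> intT Tphi Sx mA; apply/eqP; rewrite eq_le; apply/andP; split.
  apply: ge_ereal_sup => _ [y Sy <-].
  have fx : \int[mu]_(w in A) (T x w)%:E \is a fin_num.
    by apply: integrable_fin_num => //; exact: integrableS (intT x).
  rewrite leeBlDr// -leeBlDl//.
  rewrite (le_trans (lee_abs _))//.
  by have := Tphi y x A Sy Sx mA; rewrite metric_sym.
apply: ereal_sup_ubound; exists x => //.
by rewrite mdistxx mulr0 sube0.
Qed.

(** Stated as an inequality without subtraction so that it also makes sense for
infinite suprema; it holds term by term, by the triangle inequality. *)
Lemma sup_measure_lipschitz S T x y A : measurable A ->
  sup_measure mu phi S T x A <=
  sup_measure mu phi S T y A + (phi A * mdist x y)%:E.
Proof.
move=> mA; apply: ge_ereal_sup => _ [z Sz <-].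
rewrite -leeBlDr//.
apply: (@le_trans _ _ (\int[mu]_(w in A) (T z w)%:E - (phi A * mdist y z)%:E)).
  rewrite -addeA leeD2l// -EFinN -EFinB lee_fin -opprD lerN2 -mulrDr.
  apply: ler_wpM2l; first exact: phi_ge0.
  by rewrite (metric_sym x y) addrC metric_triangle.
by apply: ereal_sup_ubound; exists z.
Qed.

Lemma setwise_lipschitz_sup_measure S T :
  (forall x A, measurable A -> sup_measure mu phi S T x A \is a fin_num) ->
  setwise_lipschitz (sup_measure mu phi S T) setT.
Proof.
move=> nufin x y A _ _ mA.
case: (leP 0 (sup_measure mu phi S T x A - sup_measure mu phi S T y A))
  => [/gee0_abs|/lte0_abs] ->.
  by rewrite leeBlDl ?nufin//; exact: sup_measure_lipschitz.
rewrite fin_num_oppeB ?nufin// addeC leeBlDl ?nufin//.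
by rewrite metric_sym; exact: sup_measure_lipschitz.
Qed.

End setwise_bound.

(** * Variation of a charge *)

Section charge_total_variation.
Context d (Omega : measurableType d) (R : realType).
Variable nu : {charge set Omega -> \bar R}.

Let P := hahnP nu.
Let N := hahnN nu.
Let PN : hahn_decomposition nu P N := hahnPN nu.
Let v := charge_variation PN.
Let pos := jordan_pos PN.
Let neg := jordan_neg PN.

Let mP : measurable P. Proof. by case: PN => -[]. Qed.
Let mN : measurable N. Proof. by case: PN => _ []. Qed.

Lemma jordan_pos_hahnN : pos N = 0.
Proof.
have [_ _ _ PN0] := PN.
rewrite /pos jordan_posE cjordan_posE /crestr0 mem_set//.
by rewrite /crestr setIC PN0 charge0.
Qed.

Lemma jordan_neg_hahnP : neg P = 0.
Proof.
have [_ _ _ PN0] := PN.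
rewrite /neg jordan_negE cjordan_negE /crestr0 mem_set//.
by rewrite /crestr PN0 charge0 oppe0.
Qed.

Let pos_v : pos `<< v.
Proof.
apply/null_content_dominatesP => A mA /eqP.
by rewrite /v /charge_variation padde_eq0// => /andP[/eqP].
Qed.

Let neg_v : neg `<< v.
Proof.
apply/null_content_dominatesP => A mA /eqP.
by rewrite /v /charge_variation padde_eq0// => /andP[_ /eqP].
Qed.

Lemma charge_variation_total : v setT = nu P - nu N.
Proof.
rewrite /v /charge_variation/= jordan_posE jordan_negE.
rewrite cjordan_posE cjordan_negE.
by rewrite /crestr0 mem_set// /crestr !setTI.
Qed.

(** The [L^oo] norm is 0 by convention for the zero measure, hence the separate
case, in which every property holds almost everywhere. *)
Lemma Linfty_ball_ae_le1 (g : charge_Linfty nu) :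
  'N[v]_+oo[EFin \o g] <= 1 -> \forall x \ae v, `|(g x)%:E| <= 1.
Proof.
rewrite unlock; case: ifPn => [_ /ess_supP//|].
rewrite lt0e measure_ge0 andbT negbK => /eqP v0 _.
by exists setT; split.
Qed.

(** The integrals of [|g|] for the positive and the negative part of [nu] add up
to its integral for [v], and [|g| <= 1] almost everywhere for [v]. *)
Lemma charge_integral_le (g : charge_Linfty nu) :
  'N[v]_+oo[EFin \o g] <= 1 -> `|charge_integral nu g| <= v setT.
Proof.
move=> /Linfty_ball_ae_le1 g1.
have mg : measurable_fun setT (EFin \o g).
  exact/measurable_EFinP/measurable_Lspace.
have mag : measurable_fun setT (abse \o (EFin \o g)) by exact: measurableT_comp.
rewrite /charge_integral (le_trans (lee_abs_sub _ _))//.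
apply: (@le_trans _ _ (\int[pos]_w `|(g w)%:E| + \int[neg]_w `|(g w)%:E|)).
  by apply: leeD; exact: le_abse_integral.
have -> : \int[pos]_w `|(g w)%:E| + \int[neg]_w `|(g w)%:E| =
    \int[v]_w `|(g w)%:E|.
  rewrite -ge0_integral_measure_add//.
  by apply: eq_measure_integral => A mA _; exact: measure_addE.
rewrite -[leRHS]mul1e -integral_cst//.
apply: ae_ge0_le_integral => //.
by apply: filterS g1.
Qed.

(** The witness is the class of [1_P - 1_N]: it is 1 almost everywhere for the
positive part of [nu], which does not charge [N], and -1 almost everywhere for
the negative part. *)
Lemma exists_charge_integral_eq : exists2 g : charge_Linfty nu,
  'N[v]_+oo[EFin \o g] <= 1 & charge_integral nu g = v setT.
Proof.
pose h : Omega -> R := (\1_P \- \1_N)%R.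
have mh : measurable_fun setT h.
  by apply: measurable_funB; exact: measurable_indic.
have [_ _ PNT PN0] := PN.
have hP w : P w -> h w = 1%R.
  move=> Pw; rewrite /h /= !indicE mem_set// memNset ?subr0// => Nw.
  by have : (P `&` N) w by []; rewrite PN0.
have hN w : N w -> h w = (-1)%R.
  move=> Nw; rewrite /h /= !indicE (mem_set Nw) memNset ?sub0r// => Pw.
  by have : (P `&` N) w by []; rewrite PN0.
have h1 w : `|(h w)%:E| <= 1.
  have : (P `|` N) w by rewrite PNT.
  by case=> [/hP ->|/hN ->]; rewrite /= ?normrN normr1.
have Nh1 : 'N[v]_+oo[EFin \o h] <= 1.
  rewrite unlock; case: ifPn => // _; apply/ess_supP.
  by apply: aeW => w; exact: h1.
have [g gh] := @exists_Lspace_class _ _ _ v _ (leey 1) h mh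
  (le_lt_trans Nh1 (ltry _)).
have mg := measurable_Lspace g.
exists g.
  rewrite (@ae_eq_Lnorm _ _ _ v _ _ (EFin \o h))//.
  - exact/measurable_EFinP.
  - exact/measurable_EFinP.
  - by apply: filterS gh => w /(_ I) /= ->.
have hpos : ae_eq pos setT h (cst 1%R).
  exists N; split => //; first exact: jordan_pos_hahnN.
  move=> w /= /not_implyP[_ hw].
  have : (P `|` N) w by rewrite PNT.
  by case=> // /hP.
have hneg : ae_eq neg setT h (cst (-1)%R).
  exists P; split => //; first exact: jordan_neg_hahnP.
  move=> w /= /not_implyP[_ hw].
  have : (P `|` N) w by rewrite PNT.
  by case=> // /hN.
have -> : charge_integral nu g = pos setT - - neg setT; last by rewrite oppeK.
have gpos := ae_eq_trans (null_dominates_ae_eq measurableT pos_v gh) hpos.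
have gneg := ae_eq_trans (null_dominates_ae_eq measurableT neg_v gh) hneg.
rewrite /charge_integral; congr (_ - _).
- rewrite (ae_eq_integral (cst 1))// ?integral_cst ?mul1e//.
  + exact/measurable_EFinP.
  + by apply: filterS gpos => w /(_ I) /= ->.
- rewrite (ae_eq_integral (cst (-1)%:E))// ?integral_cst ?EFinN ?mulN1e//.
  + exact/measurable_EFinP.
  + by apply: filterS gneg => w /(_ I) /= ->.
Qed.

Lemma signed_variationE : signed_variation nu = v setT.
Proof.
apply/eqP; rewrite eq_le; apply/andP; split.
  by apply: ge_ereal_sup => _ [g g1 <-]; exact: charge_integral_le.
have [g g1 gv] := exists_charge_integral_eq.
by apply: ereal_sup_ubound; exists g; rewrite // gv gee0_abs.
Qed.

End charge_total_variation.

(** By [signed_variationE] the left-hand side is [int_P f - int_N f], which is at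
most [int |f|]. Conversely [int |f|] is [nu A - nu (~` A)] with [A] the set where
[f >= 0], and each term is bounded by the mass of [nu^+ + nu^-] on the same set. *)
Lemma signed_variation_density d (Omega : measurableType d) (R : realType)
    (mu : {measure set Omega -> \bar R}) (f : Omega -> R)
    (nu : {charge set Omega -> \bar R}) :
  mu.-integrable setT (EFin \o f) ->
  (forall A, measurable A -> nu A = \int[mu]_(w in A) (f w)%:E) ->
  signed_variation nu = \int[mu]_w `|(f w)%:E|.
Proof.
move=> intf nuE; have mf := measurable_int _ intf.
have maf : measurable_fun setT (abse \o (EFin \o f)) by exact: measurableT_comp.
have split_abs A : measurable A -> \int[mu]_w `|(f w)%:E| =
    \int[mu]_(w in A) `|(f w)%:E| + \int[mu]_(w in ~` A) `|(f w)%:E|.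
  move=> mA; rewrite -ge0_integral_setU ?setUv//.
  - exact: measurableC.
  - by apply/disj_setPCl.
rewrite signed_variationE; apply/eqP; rewrite eq_le; apply/andP; split.
  have [[mP _] [mN _] PNT PN0] := hahnPN nu.
  have NP : hahnN nu = ~` hahnP nu.
    apply/seteqP; split=> w.
      by move=> Nw Pw; have : (hahnP nu `&` hahnN nu) w by []; rewrite PN0.
    by have [] : (hahnP nu `|` hahnN nu) w by rewrite PNT.
  rewrite charge_variation_total !nuE// (split_abs _ mP) -NP.
  apply: (le_trans (lee_abs _)); apply: (le_trans (lee_abs_sub _ _)).
  by apply: leeD; apply: le_abse_integral => //; exact: measurable_funTS.
pose A := [set w | (0 <= (f w)%:E)%E].
have mA : measurable A.
  rewrite /A -[X in measurable X]setTI.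
  exact: emeasurable_fun_c_infty.
have mCA := measurableC mA.
have -> : \int[mu]_w `|(f w)%:E| = nu A - nu (~` A).
  rewrite (split_abs _ mA) !nuE//; congr (_ + _).
    by apply: eq_integral => w; rewrite inE => Aw; rewrite gee0_abs.
  rewrite -[LHS]oppeK -integral_ge0N//; congr (- _).
  apply: eq_integral => w; rewrite inE => /negP; rewrite -ltNge => f0.
  by rewrite lte0_abs// oppeK.
apply: (le_trans (lee_abs _)); apply: (le_trans (lee_abs_sub _ _)).
rewrite -(setUv A) measureU ?setICr//.
by apply: leeD; exact: abse_charge_variation.
Qed.

(** * Mu-continuous measures and their densities *)

Lemma exists_density d (Omega : measurableType d) (R : realType)
    (mu : {finite_measure set Omega -> \bar R}) (nu : set Omega -> \bar R) :
  continuous_measure mu nu -> exists f : LspaceType1 mu,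
    forall A, measurable A -> nu A = \int[mu]_(w in A) (f w)%:E.
Proof.
move=> [c cE cmu]; pose h := fine \o Radon_Nikodym c mu.
have hE : EFin \o h = Radon_Nikodym c mu.
  by apply/funext => w /=; rewrite fineK// Radon_Nikodym_fin_num.
have inth : mu.-integrable setT (EFin \o h).
  by rewrite hE; exact: Radon_Nikodym_integrable.
have mh : measurable_fun setT h.
  by apply/measurable_EFinP; exact: measurable_int inth.
have fh : finite_norm mu 1 h.
  by rewrite /finite_norm Lnorm1; case/integrableP: inth.
have [f fE] := exists_Lspace_class (lexx 1) mh fh.
exists f => A mA; rewrite -cE// (Radon_Nikodym_integral cmu mA) -hE.
apply: ae_eq_integral => //.
- by apply/measurable_funTS/measurable_EFinP.
- by apply/measurable_funTS/measurable_EFinP; exact: measurable_Lspace.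
- by apply: filterS fE => w /(_ I) /= ->.
Qed.

Lemma integral_continuous_measure d (Omega : measurableType d) (R : realType)
    (mu : {measure set Omega -> \bar R}) (f : Omega -> R)
    (nu : set Omega -> \bar R) :
  mu.-integrable setT (EFin \o f) ->
  (forall A, measurable A -> nu A = \int[mu]_(w in A) (f w)%:E) ->
  continuous_measure mu nu.
Proof.
move=> intf nuE; exists (induced_charge intf); first by move=> A /nuE.
apply/null_content_dominatesP => A mA muA; rewrite /= /induced_charge.
by apply: null_set_integral => //; exact/measurable_funTS/measurable_int/intf.
Qed.

Lemma continuous_measure_fin_num d (Omega : measurableType d) (R : realType)
    (mu : {measure set Omega -> \bar R}) (nu : set Omega -> \bar R) A :
  continuous_measure mu nu -> measurable A -> nu A \is a fin_num.
Proof. by move=> [c cE _] mA; rewrite -cE// fin_num_measure. Qed.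

Theorem proposition4p4 (R : realType) (M : metricType R) (S : set M)
    (d : measure_display) (Omega : measurableType d)
    (mu : {finite_measure set Omega -> \bar R})
    (phi : set Omega -> R)
    (phi_ge0 : nonneg_set_function phi)
    (phi_incr : increasing_set_function phi)
    (phi_bnd : bounded_set_function phi)
    (T : M -> LspaceType1 mu)
    (T_lip : phi_lipschitz (L1norm0 mu) phi S T) :
  ((forall x : M, continuous_measure mu (sup_measure mu phi S T x)) ->
   exists T' : M -> LspaceType1 mu,
     (forall x, S x -> T' x = T x) /\
     phi_lipschitz (L1norm0 mu) phi [set: M] T')
  /\
  (forall T' : M -> LspaceType1 mu,
     (forall x, S x -> T' x = T x) ->
     phi_lipschitz (L1norm0 mu) phi [set: M] T' ->
     let nuhat := sup_measure mu phi [set: M] T' in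
     [/\ forall x : M, continuous_measure mu (nuhat x),
         forall x : M, semivariation (nuhat x) = L1norm0 mu (T' x),
         forall (x : M) (c : {charge set Omega -> \bar R}),
           (forall A, measurable A -> c A = nuhat x A) ->
           signed_variation c = 'N[mu]_1[EFin \o T' x] &
         forall (x y : M) (A : set Omega), measurable A ->
           `|nuhat x A - nuhat y A| <= (phi A * mdist x y)%:E]).
Proof.
have intL (U : M -> LspaceType1 mu) x : mu.-integrable setT (EFin \o U x).
  exact: Lspace1_integrable.
split=> [nu_cont|T' _ T'_lip nuhat].
  have numE x A : S x -> measurable A ->
      sup_measure mu phi S T x A = \int[mu]_(w in A) (T x w)%:E.
    move=> Sx mA; apply: sup_measure_id => //.
    by apply/phi_lipschitz_L1norm0P.
  have /choice[D DE] x := exists_density (nu_cont x).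
  (* Keeping [T x] itself on [S] makes [T'] an extension of [T] without an appeal
     to the uniqueness of densities. *)
  pose T' x := if pselect (S x) then T x else D x.
  have T'E x A : measurable A ->
      sup_measure mu phi S T x A = \int[mu]_(w in A) (T' x w)%:E.
    by move=> mA; rewrite /T'; case: pselect => Sx; [exact: numE|exact: DE].
  exists T'; split=> [x Sx|]; first by rewrite /T'; case: pselect.
  apply/phi_lipschitz_L1norm0P => // x y A _ _ mA; rewrite -!T'E//.
  apply: setwise_lipschitz_sup_measure => // z B mB.
  exact: continuous_measure_fin_num (nu_cont z) mB.
have T'_set : setwise_lipschitz phi
    (fun x A => \int[mu]_(w in A) (T' x w)%:E) setT.
  by apply/phi_lipschitz_L1norm0P.
have nuhatE x A : measurable A -> nuhat x A = \int[mu]_(w in A) (T' x w)%:E.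
  by move=> mA; apply: sup_measure_id.
split.
- by move=> x; apply: integral_continuous_measure (intL T' x) _ => A /nuhatE.
- move=> x; rewrite /semivariation /L1norm0; congr ereal_sup.
  by apply: eq_imagel => A mA; rewrite nuhatE.
- move=> x c cE; rewrite Lnorm1.
  by apply: signed_variation_density => // A mA; rewrite cE// nuhatE.
- by move=> x y A mA; rewrite !nuhatE//; exact: T'_set.
Qed.
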